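(* Let $A\in\mathbb{R}^{n\times n}$, $B\in\mathbb{R}^{n\times m}$, and consider the linear system $x(k+1)=f(x(k),u(k))$ with $f(x,u)=Ax+Bu$, constraint set $\mathbb{Y}=\{(x,u)\in\mathbb{R}^n\times\mathbb{R}^m : g(x,u)\le 0\}$ with $g:\mathbb{R}^n\times\mathbb{R}^m\to\mathbb{R}^p$ convex (componentwise), and convex stage costs $\ell_1,\ell_2:\mathbb{Y}\to\mathbb{R}$, where at least one of the functions $\ell_1$ and $\ell_2$ is strictly convex. Assume that $\mathbb{Y}$ is convex and compact and that the following Slater condition is satisfied: there exists $(\hat x,\hat u)\in\mathbb{R}^n\times\mathbb{R}^m$ with $g(\hat x,\hat u)<0$ (componentwise) and $\hat x-A\hat x-B\hat u=0$. Then for all $\mu\in(0,1)$ the system is strictly dissipative for the cost function $\ell_\mu=\mu\ell_1+(1-\mu)\ell_2$ at the optimal equilibrium $(x_\mu^e,u_\mu^e)$, i.e. at the minimiser of $\ell_\mu(x,u)$ over all $(x,u)\in\mathbb{Y}$ with $x=Ax+Bu$.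
   Context: Let $f:\mathbb{R}^n\times\mathbb{R}^m\to\mathbb{R}^n$ be continuous, let $\mathbb{Y}\subseteq\mathbb{R}^n\times\mathbb{R}^m$ be a non-empty combined state and input constraint set, and let $\mathbb{X}:=\{x\in\mathbb{R}^n : \text{there is } u\in\mathbb{R}^m \text{ with } (x,u)\in\mathbb{Y}\}$. The system is $x(k+1)=f(x(k),u(k))$. A stage cost (cost function) is a function $\ell:\mathbb{Y}\to\mathbb{R}$. An equilibrium is a pair $(x^e,u^e)\in\mathbb{Y}$ with $x^e=f(x^e,u^e)$. $\|\cdot\|$ is an arbitrary norm on $\mathbb{R}^n$. $\mathcal{K}_\infty$ is the set of continuous, strictly increasing, unbounded functions $\alpha:[0,\infty)\to[0,\infty)$ with $\alpha(0)=0$. Inequalities between vectors in $\mathbb{R}^p$ are componentwise. The system is strictly dissipative for the stage cost $\ell$ at an equilibrium $(x^e,u^e)$ if there exist a storage function $\lambda:\mathbb{X}\to\mathbb{R}$, bounded on bounded subsets of $\mathbb{X}$ and bounded from below on $\mathbb{X}$, and $\alpha\in\mathcal{K}_\infty$ such that for all $(x,u)\in\mathbb{Y}$ with $f(x,u)\in\mathbb{X}$ $$\ell(x,u)-\ell(x^e,u^e)+\lambda(x)-\lambda(f(x,u))\ge\alpha(\|x-x^e\|).$$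
   Formalization: The stage costs ℓ1 and ℓ2 are additionally assumed lower semicontinuous on Y; without this a convex cost may jump at the boundary of Y, the minimiser need not exist, and strict dissipativity can fail even when it does. *)

(* Defs.v *)
From HB Require Import structures.
From mathcomp Require Import all_boot all_order all_algebra.
From mathcomp Require Import all_classical all_reals all_analysis.

Set Implicit Arguments.
Unset Strict Implicit.
Unset Printing Implicit Defensive.

Import Order.TTheory GRing.Theory Num.Theory.
Import numFieldNormedType.Exports.

Local Open Scope classical_set_scope.
Local Open Scope ring_scope.
Local Open Scope convex_scope.

(* A function whose domain is a subset D of a space is a total function here;
   every condition on it only involves its values on D, so that the values
   outside D are irrelevant. *)

Definition is_norm (R : realType) (V : lmodType R) (N : V -> R) : Prop :=
  [/\ forall x y : V, N (x + y) <= N x + N y,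
      forall (a : R) (x : V), N (a *: x) = `|a| * N x
    & forall x : V, N x = 0 -> x = 0].

Definition strictly_convex_function (R : realType) (E : lmodType R)
    (D : set (convex_lmodType E)) (f : convex_lmodType E -> R^o) : Prop :=
  forall t : {i01 R}, 0 < t%:num -> t%:num < 1 ->
    {in D &, forall x y : convex_lmodType E,
      x != y -> f (x <| t |> y) < f x <| t |> f y}.

(* Lower semicontinuity of l : D -> R for the topology induced on D: points
   outside D are isolated in the space subspace D. *)
Definition lower_semicontinuous_on (R : realType) (T : topologicalType)
    (D : set T) (l : T -> R) : Prop :=
  lower_semicontinuous (fun z : subspace D => (l z)%:E).

Definition K_infty (R : realType) (alpha : R -> R) : Prop :=
  [/\ {within `[0, +oo[, continuous alpha},
      {in `[0, +oo[ &, {homo alpha : r s / r < s}},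
      alpha 0 = 0
    & forall M : R, exists2 r : R, 0 <= r & M < alpha r].

Section ControlSystem.
Context {R : realType} {n m : nat}.
Local Notation state := 'cV[R]_n.
Local Notation input := 'cV[R]_m.
Implicit Types (f : state * input -> state) (Y : set (state * input)).
Implicit Types (l : state * input -> R) (e : state * input).

Definition admissible_states Y : set state :=
  [set x | exists u : input, Y (x, u)].

Definition is_equilibrium f Y e : Prop := Y e /\ e.1 = f e.

Definition is_optimal_equilibrium f Y l e : Prop :=
  is_equilibrium f Y e /\
  forall e' : state * input, is_equilibrium f Y e' -> l e <= l e'.

Definition is_storage_function (X : set state) (lambda : state -> R) : Prop :=
  (forall S : set state, S `<=` X -> bounded_set S ->
     bounded_set (lambda @` S)) /\
  has_lbound (lambda @` X).

Definition strictly_dissipative (N : state -> R) f Y l e : Prop :=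
  exists lambda : state -> R, is_storage_function (admissible_states Y) lambda /\
  exists alpha : R -> R, K_infty alpha /\
  forall (x : state) (u : input),
    Y (x, u) -> admissible_states Y (f (x, u)) ->
    alpha (N (x - e.1)) <= l (x, u) - l e + lambda x - lambda (f (x, u)).

Definition linear_dynamics (A : 'M[R]_n) (B : 'M[R]_(n, m))
    (z : state * input) : state := A *m z.1 + B *m z.2.

End ControlSystem.

(* Main.v *)
Require Import Defs.
From HB Require Import structures.
From mathcomp Require Import all_boot all_order all_algebra.
From mathcomp Require Import all_classical all_reals all_analysis.
From mathcomp Require Import ring lra.

Set Implicit Arguments.
Unset Strict Implicit.
Unset Printing Implicit Defensive.

Import Order.TTheory GRing.Theory Num.Theory.
Import numFieldNormedType.Exports.

Local Open Scope classical_set_scope.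
Local Open Scope ring_scope.

(** Write the equilibrium condition as finitely many scalar equations
    h_i (z) = 0, where h_i (x, u) is the i-th entry of x - A x - B u, and let
    e minimise the strictly convex cost l_mu over the equilibria in Y.  The
    optimality of e is a convex programme with linear equality constraints,
    and the proof consists in reading its Lagrange multipliers c_i as a linear
    storage function lambda (x) = sum_i c_i x_i: by linearity
    sum_i c_i h_i (x, u) = lambda (x) - lambda (A x + B u), so the function
    phi (z) = l_mu (z) - l_mu (e) + sum_i c_i h_i (z)
    is exactly the dissipated quantity, and duality (lemma [multipliers]) says
    that it is nonnegative on Y.

    The multipliers are found without a separation theorem.  The equations are
    removed one at a time; for a single equation h = 0, a suitable c is the
    supremum of - phi / h over the points with h > 0, and convexity of phi
    along segments that cross the hyperplane h = 0 bounds this supremum by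
    what the points with h < 0 require (lemma [multiplier1]).  Slater's
    condition provides an equilibrium from which one can move a little in the
    direction opposite to any point of Y without leaving Y.  This relative
    interiority survives intersection with the hyperplanes through the Slater
    point, and guarantees that points of both signs of h occur together.

    Since phi is strictly convex and nonnegative, and phi (e) = 0, its only
    zero in Y is e.  It remains to bound phi from below by a K_infty function of
    d (z) = N (x - x_e).  The function
    alpha (r) = min over z in Y of phi (z) + max (0, r - d (z))
    does it (lemma [K_infty_lower_bound]): minima exist because Y is compact
    and phi is lower semicontinuous, alpha is 1-Lipschitz, positive for r > 0,
    and shrinking Y towards e gives alpha (t r) <= t alpha (r), whence alpha
    is strictly increasing and unbounded. *)

(** * Convexity and Lagrange multipliers for linear equations *)

Section Convexity.
Context {R : realType} {E : lmodType R}.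
Implicit Types (Y : set E) (phi psi : E -> R) (h : {scalar E}).

Lemma convex_set_comb Y t x y : convex_set Y -> 0 <= t -> t <= 1 ->
  Y x -> Y y -> Y (t *: x + (1 - t) *: y).
Proof.
move=> cY t0 t1 Yx Yy.
by have := cY x y (Itv01 t0 t1) (mem_set Yx) (mem_set Yy); rewrite inE.
Qed.

Lemma convex_function_comb Y phi t x y : convex_function Y phi ->
  0 <= t -> t <= 1 -> Y x -> Y y ->
  phi (t *: x + (1 - t) *: y) <= t * phi x + (1 - t) * phi y.
Proof.
move=> cphi t0 t1 Yx Yy.
exact: (cphi (Itv01 t0 t1) x y (mem_set Yx) (mem_set Yy)).
Qed.

Lemma strictly_convex_function_comb Y phi t x y :
  strictly_convex_function Y phi -> 0 < t -> t < 1 -> Y x -> Y y -> x != y ->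
  phi (t *: x + (1 - t) *: y) < t * phi x + (1 - t) * phi y.
Proof.
move=> cphi t0 t1 Yx Yy xy.
exact: (cphi (Itv01 (ltW t0) (ltW t1)) t0 t1 x y (mem_set Yx) (mem_set Yy)).
Qed.

Lemma convex_functionS Y Z phi :
  Z `<=` Y -> convex_function Y phi -> convex_function Z phi.
Proof.
move=> ZY cphi t x y /set_mem/ZY Yx /set_mem/ZY Yy.
exact: cphi (mem_set _) (mem_set _).
Qed.

Lemma weighted_sum_comb k (c : 'I_k -> R) (h : 'I_k -> {scalar E}) t s x y :
  \sum_i c i * h i (t *: x + s *: y) =
  t * (\sum_i c i * h i x) + s * (\sum_i c i * h i y).
Proof.
rewrite !mulr_sumr -big_split/=; apply: eq_bigr => i _.
by rewrite linearD !linearZ /=; ring.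
Qed.

Lemma convex_functionD_scalar k (c : 'I_k -> R) (h : 'I_k -> {scalar E}) Y phi :
  convex_function Y phi ->
  convex_function Y (fun z => phi z + \sum_i c i * h i z).
Proof.
move=> cphi t x y xY yY; have := cphi t x y xY yY.
by rewrite !convRE weighted_sum_comb; lra.
Qed.

Lemma strictly_convex_functionD_scalar k (c : 'I_k -> R)
    (h : 'I_k -> {scalar E}) Y phi :
  strictly_convex_function Y phi ->
  strictly_convex_function Y (fun z => phi z + \sum_i c i * h i z).
Proof.
move=> cphi t t0 t1 x y xY yY xy; have := cphi t t0 t1 x y xY yY xy.
by rewrite !convRE weighted_sum_comb; lra.
Qed.

Lemma convex_functionB_cst Y phi a : convex_function Y phi ->
  convex_function Y (fun z => phi z - a).
Proof.
move=> cphi t x y xY yY; have := cphi t x y xY yY.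
by rewrite !convRE /unstable.onem; lra.
Qed.

Lemma strictly_convex_functionB_cst Y phi a : strictly_convex_function Y phi ->
  strictly_convex_function Y (fun z => phi z - a).
Proof.
move=> cphi t t0 t1 x y xY yY xy; have := cphi t t0 t1 x y xY yY xy.
by rewrite !convRE /unstable.onem; lra.
Qed.

Lemma convex_function_comb2 Y phi psi a b : 0 <= a -> 0 <= b ->
  convex_function Y phi -> convex_function Y psi ->
  convex_function Y (fun z => a * phi z + b * psi z).
Proof.
move=> a0 b0 cphi cpsi t x y xY yY.
have := ler_wpM2l a0 (cphi t x y xY yY).
have := ler_wpM2l b0 (cpsi t x y xY yY).
by rewrite !convRE; lra.
Qed.

Lemma strictly_convex_function_comb2 Y phi psi a b : 0 < a -> 0 <= b ->
  strictly_convex_function Y phi -> convex_function Y psi ->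
  strictly_convex_function Y (fun z => a * phi z + b * psi z).
Proof.
move=> a0 b0 cphi cpsi t t0 t1 x y xY yY xy.
have := cphi t t0 t1 x y xY yY xy; rewrite -(ltr_pM2l a0).
have := ler_wpM2l b0 (cpsi t x y xY yY).
by rewrite !convRE; lra.
Qed.

Lemma strictly_convex_argmin_unique Y phi x y :
  convex_set Y -> strictly_convex_function Y phi -> Y x -> Y y ->
  (forall z, Y z -> phi x <= phi z) -> phi y <= phi x -> x = y.
Proof.
move=> cY cphi Yx Yy phix phiy; apply/eqP/negP => /negP xy.
have h0 : 0 < 1 / 2 :> R by lra.
have h1 : 1 / 2 < 1 :> R by lra.
have := strictly_convex_function_comb cphi h0 h1 Yx Yy xy.
have := phix _ (convex_set_comb cY (ltW h0) (ltW h1) Yx Yy).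
by move=> /le_lt_trans/[apply]; lra.
Qed.

Lemma convex_set_ker Y h :
  convex_set Y -> convex_set (Y `&` [set z | h z = 0]).
Proof.
move=> cY x y t /set_mem[Yx hx] /set_mem[Yy hy]; rewrite inE; split.
  by apply: set_mem; apply: cY; exact: mem_set.
by rewrite /conv /= linearD !linearZ /= hx hy !mulr0 addr0.
Qed.

(** For a convex subset of a finite-dimensional space this is the usual
    relative interior: every segment of Y ending at z0 can be prolonged beyond
    z0.  No topology is involved, so the notion passes to sections of Y by
    hyperplanes through z0. *)
Definition relative_interior Y z0 :=
  Y z0 /\ forall z, Y z -> exists2 eps, 0 < eps & Y (z0 - eps *: (z - z0)).

Lemma relative_interior_ker Y h z0 : h z0 = 0 ->
  relative_interior Y z0 -> relative_interior (Y `&` [set z | h z = 0]) z0.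
Proof.
move=> hz0 [Yz0 reflY]; split=> // z [/reflY[eps eps0 Yeps] hz].
exists eps => //; split=> //=.
by rewrite linearB linearZ linearB /= hz0 hz subrr mulr0 subrr.
Qed.

(** A point x with h x > 0 requires c >= - phi x / h x, and a point y with
    h y < 0 requires c <= phi y / - h y.  These requirements are compatible
    because the segment from x to y meets the hyperplane h = 0, where phi is
    nonnegative.  Relative interiority of z0 excludes the degenerate case of
    points of one sign only, where the supremum could be infinite. *)
Lemma multiplier1 Y phi h z0 :
  convex_set Y -> convex_function Y phi -> relative_interior Y z0 -> h z0 = 0 ->
  (forall z, Y z -> h z = 0 -> 0 <= phi z) ->
  exists c, forall z, Y z -> 0 <= phi z + c * h z.
Proof.
move=> cY cphi [Yz0 reflY] hz0 phi_ge0.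
(* Reflecting z through z0 yields a point where h has the opposite sign. *)
have opp z : Y z -> exists2 w, Y w & exists2 eps, 0 < eps & h w = - eps * h z.
  move=> /reflY[eps eps0 Yw]; exists (z0 - eps *: (z - z0)) => //.
  by exists eps => //; rewrite linearB linearZ linearB /= hz0 subr0 sub0r mulNr.
have [[a Ya ha]|npos] := pselect (exists2 a, Y a & 0 < h a); last first.
  have h_le0 z : Y z -> h z <= 0.
    by move=> Yz; rewrite leNgt; apply/negP => hz; apply: npos; exists z.
  exists 0 => z Yz; rewrite mul0r addr0 phi_ge0//.
  apply/eqP; rewrite eq_le h_le0//=.
  have [w Yw [eps eps0 hw]] := opp z Yz.
  by have := h_le0 w Yw; rewrite hw mulNr oppr_le0 pmulr_rge0.
have cross x y : Y x -> Y y -> 0 < h x -> h y < 0 ->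
    - phi x / h x <= phi y / - h y.
  move=> Yx Yy hx hy; have d0 : 0 < h x - h y by lra.
  (* The weight for which t x + (1 - t) y lies on the hyperplane h = 0. *)
  have [t tdef] : exists t, t = - h y / (h x - h y) by eexists.
  have tE : 1 - t = h x / (h x - h y) by rewrite tdef; field; rewrite gt_eqF.
  have t0 : 0 <= t by rewrite tdef divr_ge0//; lra.
  have t1 : t <= 1 by rewrite -subr_ge0 tE divr_ge0//; lra.
  have := convex_function_comb cphi t0 t1 Yx Yy.
  have : 0 <= phi (t *: x + (1 - t) *: y).
    apply: phi_ge0; first exact: convex_set_comb.
    by rewrite linearD !linearZ /= tE tdef; field; rewrite gt_eqF.
  move=> /le_trans/[apply]; rewrite tE tdef.
  have -> : - h y / (h x - h y) * phi x + h x / (h x - h y) * phi y =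
    (- h y * phi x + h x * phi y) / (h x - h y).
    by field; rewrite gt_eqF.
  rewrite pmulr_lge0 ?invr_gt0// => ge0.
  by rewrite ler_pdivrMr// mulrAC ler_pdivlMr ?oppr_gt0//; lra.
pose S := [set - phi x / h x | x in Y `&` [set x | 0 < h x]].
have S0 : S !=set0 by exists (- phi a / h a), a.
have ubS y : Y y -> h y < 0 -> ubound S (phi y / - h y).
  by move=> Yy hy _ [x [Yx hx] <-]; exact: cross.
have S_ub : has_ubound S.
  have [b Yb [eps eps0 hb]] := opp a Ya; exists (phi b / - h b).
  by apply: ubS => //; rewrite hb mulNr oppr_lt0 mulr_gt0.
exists (sup S) => z Yz; have [hz|hz|hz] := ltgtP (h z) 0.
- have := ge_sup S0 (ubS z Yz hz).
  by rewrite ler_pdivlMr ?oppr_gt0//; lra.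
- have : - phi z / h z <= sup S by apply: ub_le_sup => //; exists z.
  by rewrite ler_pdivrMr//; lra.
- by rewrite hz mulr0 addr0 phi_ge0.
Qed.

(** Strong duality under linear equality constraints.  The section of Y by the
    first equation is again convex with z0 in its relative interior, so the
    other equations can be dualised over it; the sum obtained is convex and
    nonnegative on this section, and the first equation is then dualised over
    the whole of Y. *)
Lemma multipliers k (h : 'I_k -> {scalar E}) Y phi z0 :
  convex_set Y -> convex_function Y phi -> relative_interior Y z0 ->
  (forall i, h i z0 = 0) ->
  (forall z, Y z -> (forall i, h i z = 0) -> 0 <= phi z) ->
  exists c : 'I_k -> R, forall z, Y z -> 0 <= phi z + \sum_i c i * h i z.
Proof.
elim: k h Y phi => [|k IH] h Y phi cY cphi Yz0 hz0 phi_ge0.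
  exists (fun=> 0) => z Yz; rewrite big_ord0 addr0.
  by apply: phi_ge0 => // -[].
pose Z := Y `&` [set z | h ord0 z = 0].
have [c cP] : exists c, forall z, Z z ->
    0 <= phi z + \sum_i c i * h (lift ord0 i) z.
  apply: IH.
  - exact: convex_set_ker.
  - by apply: convex_functionS cphi => z [].
  - exact: relative_interior_ker.
  - by move=> i; exact: hz0.
  - move=> z [Yz hz] hz'; apply: phi_ge0 => // i.
    by case: (unliftP ord0 i) => [j|] ->.
pose psi z := phi z + \sum_i c i * h (lift ord0 i) z.
have [c0 c0P] : exists c0, forall z, Y z -> 0 <= psi z + c0 * h ord0 z.
  apply: (multiplier1 (z0 := z0)) => //; first exact: convex_functionD_scalar.
  by move=> z Yz hz; exact: cP.
exists (fun i => if unlift ord0 i is Some j then c j else c0) => z Yz.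
rewrite big_ord_recl unlift_none.
under eq_bigr do rewrite liftK.
by rewrite [X in phi z + X]addrC addrA; exact: c0P.
Qed.

End Convexity.

(** * Minima of lower semicontinuous functions *)

Section LowerSemicontinuity.
Context {R : realType} {T : topologicalType}.
Implicit Types (Y : set T) (l : T -> R).

Lemma lower_semicontinuous_onP Y l : lower_semicontinuous_on Y l <->
  forall z a, Y z -> a < l z -> \forall w \near within Y (nbhs z), a < l w.
Proof.
split=> [lscl z a Yz az|lscl z a].
  have [|V] := lscl z a; first by rewrite lte_fin.
  rewrite /nbhs/= -nbhs_subspace_in// => YV Vl.
  by apply: filterS YV => w /Vl; rewrite lte_fin.
rewrite lte_fin => az; case: (pselect (Y z)) => [Yz|nYz].
  exists [set w | a < l w]; last by move=> w; rewrite /= lte_fin.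
  by rewrite /nbhs/= -nbhs_subspace_in//; exact: lscl.
exists [set z]; last by move=> w ->; rewrite lte_fin.
by rewrite /nbhs/= -nbhs_subspace_out.
Qed.

Lemma lower_semicontinuous_onD Y l l' : lower_semicontinuous_on Y l ->
  lower_semicontinuous_on Y l' ->
  lower_semicontinuous_on Y (fun z => l z + l' z).
Proof.
move=> /lower_semicontinuous_onP lscl /lower_semicontinuous_onP lscl'.
apply/lower_semicontinuous_onP => z a Yz az.
pose d := (l z + l' z - a) / 2.
have d0 : 0 < d by rewrite /d; lra.
have lz : l z - d < l z by lra.
have lz' : l' z - d < l' z by lra.
apply: filterS2 (lscl z _ Yz lz) (lscl' z _ Yz lz') => w.
by rewrite /d; lra.
Qed.

Lemma lower_semicontinuous_onZ Y l c : 0 < c -> lower_semicontinuous_on Y l ->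
  lower_semicontinuous_on Y (fun z => c * l z).
Proof.
move=> c0 /lower_semicontinuous_onP lscl.
apply/lower_semicontinuous_onP => z a Yz; rewrite mulrC -ltr_pdivrMr// => az.
by apply: filterS (lscl z _ Yz az) => w; rewrite ltr_pdivrMr// mulrC.
Qed.

Lemma continuous_lower_semicontinuous_on Y l :
  continuous l -> lower_semicontinuous_on Y l.
Proof.
move=> cl; apply/lower_semicontinuous_onP => z a _ az.
by apply: cvg_within; exact: cvgr_gt (cl z) _ az.
Qed.

Lemma lower_semicontinuous_onS Y Z l : Z `<=` Y ->
  lower_semicontinuous_on Y l -> lower_semicontinuous_on Z l.
Proof.
move=> ZY /lower_semicontinuous_onP lscl.
apply/lower_semicontinuous_onP => z a /ZY Yz az.
have := lscl z a Yz az; rewrite !near_withinE.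
by apply: filterS => w Yw /ZY; exact: Yw.
Qed.

(** The sublevel sets {l <= l w} in Y generate a proper filter, since they are
    totally ordered by inclusion; a cluster point of it is a minimiser.  This
    gives boundedness from below at the same time. *)
Lemma compact_lsc_min Y l : compact Y -> Y !=set0 ->
  lower_semicontinuous_on Y l ->
  exists2 z, Y z & forall w, Y w -> l z <= l w.
Proof.
move=> cY [z0 Yz0] /lower_semicontinuous_onP lscl.
pose F := filter_from Y (fun w => Y `&` [set v | l v <= l w]).
have FF : ProperFilter F.
  apply: filter_from_proper; last by move=> w Yw; exists w; split => /=.
  apply: filter_from_filter; first by exists z0.
  move=> u v Yu Yv; have [uv|/ltW vu] := leP (l u) (l v).
    by exists u => // w [Yw wu]; split; split=> //; exact: le_trans uv.
  by exists v => // w [Yw wv]; split; split=> //; exact: le_trans vu.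
have [|z [Yz Fz]] := cY F FF; first by exists z0 => // w [].
exists z => // w Yw; rewrite leNgt; apply/negP => wz.
have [v [[Yv vw]]] : (Y `&` [set v | l v <= l w]) `&`
    [set v | Y v -> l w < l v] !=set0.
  by apply: Fz; [exists w|exact: lscl wz].
by move=> /(_ Yv); rewrite ltNge => /negP; apply.
Qed.

End LowerSemicontinuity.

(** * Comparison functions below a cost *)

Section Gauge.
Context {R : realType} {T : topologicalType}.

(** The last hypothesis holds for a convex phi and a norm d centred at e, with
    z' = t z + (1 - t) e.  The bound r |-> inf {phi z : d z >= r} would be the
    natural choice of alpha, but it need not be continuous and is infinite for
    large r; replacing the constraint d z >= r by the penalty max 0 (r - d z)
    makes it 1-Lipschitz and finite. *)
Lemma K_infty_lower_bound (Y : set T) (phi d : T -> R) (e : T) :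
  compact Y -> Y e -> lower_semicontinuous_on Y phi -> continuous d ->
  phi e = 0 -> d e = 0 -> (forall z, 0 <= d z) ->
  (forall z, Y z -> 0 <= phi z) ->
  (forall z, Y z -> phi z = 0 -> z = e) ->
  (forall z t, Y z -> 0 < t -> t < 1 ->
    exists z', [/\ Y z', phi z' <= t * phi z & d z' = t * d z]) ->
  exists2 alpha, K_infty alpha & forall z, Y z -> alpha (d z) <= phi z.
Proof.
move=> cY Ye lscphi cd phie de d_ge0 phi_ge0 phi_eq0 shrink.
pose G r z := phi z + Num.max 0 (r - d z).
have lscG r : lower_semicontinuous_on Y (G r).
  apply: lower_semicontinuous_onD => //.
  apply: continuous_lower_semicontinuous_on => z.
  apply: (@continuous_max _ _ (cst 0) (fun w => r - d w)); first exact: cvg_cst.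
  by apply: cvgB; [exact: cvg_cst|exact: cd].
have /choice[w wP] : forall r, exists w, Y w /\ forall z, Y z -> G r w <= G r z.
  move=> r; have [|w Yw wmin] := compact_lsc_min cY _ (lscG r).
    by exists e.
  by exists w.
pose alpha r := G r (w r).
have alpha_le r z : Y z -> alpha r <= G r z by exact: (wP r).2.
have alpha_ge0 r : 0 <= alpha r.
  by rewrite addr_ge0// ?le_max ?lexx//; apply: phi_ge0; exact: (wP r).1.
have alpha0 : alpha 0 = 0.
  apply/eqP; rewrite eq_le alpha_ge0 andbT (le_trans (alpha_le 0 e Ye))//.
  by rewrite /G phie de subrr maxxx addr0.
have alpha_gt0 r : 0 < r -> 0 < alpha r.
  move=> r0; rewrite lt_neqAle alpha_ge0 andbT; apply/negP => /eqP/esym/eqP.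
  rewrite /alpha /G paddr_eq0 ?le_max ?lexx//; last first.
    by apply: phi_ge0; exact: (wP r).1.
  move=> /andP[/eqP /(phi_eq0 _ (wP r).1) -> /eqP].
  rewrite de subr0 max_r ?ltW// => rE.
  by rewrite rE ltxx in r0.
have alpha_lip r s : alpha r <= alpha s + `|r - s|.
  rewrite (le_trans (alpha_le r _ (wP s).1))// /alpha /G -addrA lerD2l.
  rewrite ge_max addr_ge0 ?le_max ?lexx//=.
  have := ler_norm (r - s).
  have : s - d (w s) <= Num.max 0 (s - d (w s)) by rewrite le_max lexx orbT.
  lra.
have alpha_scale r t : 0 < t -> t < 1 -> alpha (t * r) <= t * alpha r.
  move=> t0 t1; have [z [Yz phiz dz]] := shrink _ _ (wP r).1 t0 t1.
  rewrite (le_trans (alpha_le _ _ Yz))// /alpha /G mulrDr lerD//.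
  by rewrite dz -mulrBr maxr_pMr ?mulr0// ltW.
exists alpha; last first.
  by move=> z Yz; rewrite (le_trans (alpha_le _ _ Yz))// /G subrr maxxx addr0.
split=> //.
- apply: continuous_subspaceT => r; apply/cvgrPdist_le => eps eps0.
  near=> s; have : `|r - s| <= eps by near: s; exact: cvgr_dist_le eps0.
  apply: le_trans; have := alpha_lip s r; rewrite distrC => h1.
  by rewrite ler_norml; have := alpha_lip r s; lra.
- move=> r s; rewrite !in_itv/= !andbT => r0 s0 rs.
  have [->|rN0] := eqVneq r 0.
    by rewrite alpha0 alpha_gt0// (le_lt_trans r0).
  have s_gt0 : 0 < s by rewrite (le_lt_trans r0).
  have t0 : 0 < r / s by rewrite divr_gt0// lt_neqAle eq_sym rN0.
  have t1 : r / s < 1 by rewrite ltr_pdivrMr// mul1r.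
  have := alpha_scale s _ t0 t1; rewrite mulfVK ?gt_eqF//.
  move=> /le_lt_trans; apply.
  by rewrite gtr_pMl// alpha_gt0.
- (* alpha 1 <= alpha r / r for r > 1, so alpha grows at least linearly. *)
  move=> M; have a1 : 0 < alpha 1 by exact: alpha_gt0.
  have q0 : 0 <= `|M| / alpha 1 by rewrite divr_ge0// ltW.
  have [r r_gt1 Mr] : exists2 r, 1 < r & M < r * alpha 1.
    exists (2 + `|M| / alpha 1); first by lra.
    by rewrite mulrDl divfK ?gt_eqF// (le_lt_trans (ler_norm M))// ltrDr; lra.
  have r0 : 0 < r by lra.
  exists r; first exact: ltW.
  have := @alpha_scale r r^-1; rewrite invr_gt0 invf_lt1// mulVf ?gt_eqF//.
  by move=> /(_ r0 r_gt1); rewrite ler_pdivlMl//; exact: lt_le_trans.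
Unshelve. all: by end_near. Qed.

End Gauge.

(** * Continuity of linear forms and of norms on column vectors *)

Section FiniteDimension.
Context {R : realType}.

Lemma continuous_sum_real (T : topologicalType) k (F : 'I_k -> T -> R) :
  (forall i, continuous (F i)) -> continuous (fun z => \sum_i F i z).
Proof.
by move=> cF; apply: continuous_big => //; exact: add_continuous.
Qed.

Lemma continuous_mulr (T : topologicalType) (F : T -> R) c :
  continuous F -> continuous (fun z => F z * c).
Proof. by move=> cF z; apply: cvgM; [exact: cF|exact: cvg_cst]. Qed.

Lemma continuous_majorant (T : topologicalType) (F M : T -> R) x :
  (forall y, `|F x - F y| <= M y) -> M x = 0 -> {for x, continuous M} ->
  {for x, continuous F}.
Proof.
move=> FM Mx /cvgrPdist_le cM; apply/cvgrPdist_le => eps /cM.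
apply: filterS => y; rewrite Mx sub0r normrN; apply: le_trans.
by rewrite (le_trans (FM y))// ler_norm.
Qed.

Lemma continuous_scalar_cV k (h : {scalar 'cV[R]_k}) : continuous h.
Proof.
have -> : (h : _ -> R) = fun x => \sum_i x i ord0 * h (delta_mx i ord0).
  apply/funext => x; rewrite {1}[x]matrix_sum_delta linear_sum/=.
  by apply: eq_bigr => i _; rewrite big_ord1 linearZ.
apply: continuous_sum_real => i.
exact/continuous_mulr/(@coord_continuous R k 1 i ord0).
Qed.

Lemma norm_ge0 (V : lmodType R) (N : V -> R) : is_norm N -> forall x, 0 <= N x.
Proof.
move=> [ND NZ _] x.
have N0 : N 0 = 0 by rewrite -(scale0r 0) NZ normr0 mul0r.
by have := ND x (-1 *: x); rewrite NZ normrN1 mul1r scaleN1r subrr N0; lra.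
Qed.

(** An arbitrary norm is dominated by the sum of the |x_i| N (delta_i), which
    is continuous for the product topology. *)
Lemma continuous_norm_cV k (N : 'cV[R]_k -> R) : is_norm N -> continuous N.
Proof.
move=> /[dup] /norm_ge0 N_ge0 [ND NZ _].
have NB x y : N (x - y) = N (y - x).
  by rewrite -opprB -scaleN1r NZ normrN1 mul1r.
have N_le x : N x <= \sum_i `|x i ord0| * N (delta_mx i ord0).
  rewrite {1}[x]matrix_sum_delta.
  elim/big_ind2: _ => [|a b u v ua vb|i _]; last by rewrite big_ord1 NZ.
    by rewrite -(scale0r 0) NZ normr0 mul0r.
  by rewrite (le_trans (ND _ _))// lerD.
move=> x; pose M y : R := \sum_i `|(x - y) i ord0| * N (delta_mx i ord0).
apply: (continuous_majorant (M := M)).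
- move=> y; rewrite (le_trans _ (N_le _))// ler_norml.
  have := ND (x - y) y; have := ND (y - x) x; rewrite !subrK -(NB x y).
  lra.
- by rewrite /M big1// => i _; rewrite subrr mxE normr0 mul0r.
- apply: continuous_sum_real => i; apply: continuous_mulr.
  have -> : (fun y => `|(x - y) i ord0|) = (fun a => `|x i ord0 - a|) \o
      (fun y : 'cV[R]_k => y i ord0) by apply/funext => y; rewrite /= !mxE.
  move=> y; apply: continuous_comp; first exact: coord_continuous.
  by apply: cvg_norm; apply: cvgB; [exact: cvg_cst|exact: cvg_id].
Qed.

End FiniteDimension.

(** * Slater's condition *)

Section Slater.
Context {R : realType} {E : lmodType R}.

(** Every point z0 - eps (z - z0) lies on the segment from z0 to its reflection
    w = z0 - (z - z0), and convexity of g along this segment suffices: a small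
    weight eps of w cannot compensate g z0 < 0. *)
Lemma slater_relative_interior p (g : 'I_p -> E -> R) z0 :
  (forall i, convex_function setT (g i)) -> (forall i, g i z0 < 0) ->
  relative_interior [set z | forall i, g i z <= 0] z0.
Proof.
move=> cg gz0; split=> [i|z _]; first exact: ltW.
pose w := z0 - (z - z0).
pose b i := - g i z0 / (- g i z0 + `|g i w|).
have d0 i : 0 < - g i z0 + `|g i w|.
  by have := gz0 i; have := normr_ge0 (g i w); lra.
have b0 i : 0 < b i by rewrite divr_gt0// oppr_gt0.
have [eps [eps0 [eps1 epsb]]] :
    exists eps, 0 < eps /\ eps < 1 /\ forall i, eps < b i.
  have : \forall eps \near (0 : R)^'+,
      0 < eps /\ eps < 1 /\ forall i, eps < b i.
    near=> eps; split; [|split] => //.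
    by near: eps; apply: filter_forall => i; exact: nbhs_right_lt.
  by move=> /filter_ex.
exists eps => // i.
have -> : z0 - eps *: (z - z0) = eps *: w + (1 - eps) *: z0.
  by rewrite [eps *: w]scalerBr scalerBl scale1r [RHS]addrC addrA subrK.
have := convex_function_comb (cg i) (ltW eps0) (ltW eps1)
  (I : setT w) (I : setT z0).
move=> /le_trans; apply.
have := epsb i; rewrite /b ltr_pdivlMr// => epsi.
have : eps * g i w <= eps * `|g i w| by rewrite ler_pM2l// ler_norm.
lra.
Unshelve. all: by end_near. Qed.

End Slater.

(** * Equilibria of a linear system *)

Section EquilibriumDefect.
Context {R : realType} {n m : nat}.
Context (A : 'M[R]_n) (B : 'M[R]_(n, m)).
Local Notation state := 'cV[R]_n.
Local Notation input := 'cV[R]_m.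

Definition defect (i : 'I_n) (z : state * input) : R :=
  (z.1 - linear_dynamics A B z) i ord0.

Lemma defect_is_scalar i : scalar (defect i).
Proof.
move=> a x y; rewrite /defect /linear_dynamics /= !mulmxDr -!scalemxAr !mxE.
by ring.
Qed.

HB.instance Definition _ i :=
  GRing.isLinear.Build R (state * input)%type R *%R (defect i)
    (defect_is_scalar i).

Lemma equilibrium_defectP (Y : set (state * input)) z :
  is_equilibrium (linear_dynamics A B) Y z <->
  Y z /\ forall i, defect i z = 0.
Proof.
split=> [[Yz zE]|[Yz zE]]; split=> //.
  by move=> i; rewrite /defect -zE subrr mxE.
by apply/subr0_eq/matrixP => i j; rewrite (ord1 j) [RHS]mxE; exact: zE.
Qed.

Lemma continuous_defect i : continuous (defect i).
Proof.
pose hA := (fun x : state => defect i (x, 0)).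
pose hB := (fun u : input => defect i (0, u)).
have lA : scalar hA.
  move=> a x y; rewrite -linearP; congr defect.
  by apply: injective_projections; rewrite /= ?scaler0 ?addr0.
have lB : scalar hB.
  move=> a x y; rewrite -linearP; congr defect.
  by apply: injective_projections; rewrite /= ?scaler0 ?addr0.
pose HX : {scalar state} :=
  HB.pack hA (GRing.isLinear.Build R state R *%R hA lA).
pose HU : {scalar input} :=
  HB.pack hB (GRing.isLinear.Build R input R *%R hB lB).
have -> : defect i = fun z => HX z.1 + HU z.2.
  apply/funext => z; rewrite /= /hA /hB -raddfD /=; congr defect.
  by apply: injective_projections; rewrite /= ?addr0 ?add0r.
move=> z; apply: cvgD.
  apply: (@continuous_comp _ _ _ fst HX); first exact: cvg_fst.
  exact: continuous_scalar_cV.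
apply: (@continuous_comp _ _ _ snd HU); first exact: cvg_snd.
exact: continuous_scalar_cV.
Qed.

Lemma optimal_equilibrium_exists (Y : set (state * input))
    (l : state * input -> R) : compact Y -> lower_semicontinuous_on Y l ->
  (exists z, is_equilibrium (linear_dynamics A B) Y z) ->
  exists e, is_optimal_equilibrium (linear_dynamics A B) Y l e.
Proof.
move=> cY lscl [z0 /equilibrium_defectP[Yz0 z0E]].
pose K := Y `&` [set z | forall i, defect i z = 0].
have [|||e [Ye eE] emin] := @compact_lsc_min _ _ K l.
- apply: compact_closedI => //.
  have -> : [set z | forall i, defect i z = 0] =
      \bigcap_i (defect i @^-1` [set 0]).
    by apply/seteqP; split=> z zE i; [move=> _|]; exact: zE.
  apply: closed_bigI => i _; apply: preimage_closed; last exact: closed_eq.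
  by move=> z _; exact: continuous_defect.
- by exists z0.
- by apply: lower_semicontinuous_onS lscl => z [].
exists e; split; first exact/equilibrium_defectP.
by move=> z /equilibrium_defectP; exact: emin.
Qed.

Lemma linear_storage_function (Y : set (state * input)) (lambda : state -> R) :
  compact Y -> continuous lambda ->
  is_storage_function (admissible_states Y) lambda.
Proof.
move=> cY clambda.
have XE : admissible_states Y = fst @` Y.
  apply/seteqP; split=> [x [u Yxu]|_ [[x u] Yxu <-]]; last by exists u.
  by exists (x, u).
have : compact (lambda @` admissible_states Y).
  apply: continuous_compact; first exact: continuous_subspaceT.
  rewrite XE; apply: continuous_compact => //.
  by apply: continuous_subspaceT => z; exact: cvg_fst.
move=> /compact_bounded [M [_ boundM]]; split.
  move=> S SX _; exists M; split; first exact: num_real.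
  by move=> r Mr _ [x /SX Xx <-]; apply: boundM => //; exists x.
exists (- (M + 1)) => _ [x Xx <-].
have /(_ (lambda x)) :
    forall r, (lambda @` admissible_states Y) r -> `|r| <= M + 1.
  by apply: boundM; rewrite ltrDl.
by rewrite ler_norml => /(_ _)/andP[]//; exists x.
Qed.

End EquilibriumDefect.

(** * Strict dissipativity *)

(* Lower semicontinuity of the stage costs on Y is assumed: without it the
   minimiser need not exist, and the conclusion can fail even when it does.
   For instance A = 1, B = 0, Y = [-1/2, 1/2] x [0, 1], and both costs equal
   to u^2 (1 + x^2) for u > 0 and to x^2 for u = 0. *)
Theorem theorem3p4 (R : realType) (n m p : nat)
  (N : 'cV[R]_n -> R) (N_norm : is_norm N)
  (A : 'M[R]_n) (B : 'M[R]_(n, m))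
  (g : 'cV[R]_n * 'cV[R]_m -> 'cV[R]_p)
  (g_convex : forall i : 'I_p, convex_function setT (fun z => g z i ord0))
  (Y : set ('cV[R]_n * 'cV[R]_m))
  (Y_def : Y = [set z | forall i : 'I_p, g z i ord0 <= 0])
  (l1 l2 : 'cV[R]_n * 'cV[R]_m -> R)
  (l1_convex : convex_function Y l1) (l2_convex : convex_function Y l2)
  (l_strict : strictly_convex_function Y l1 \/ strictly_convex_function Y l2)
  (l1_lsc : lower_semicontinuous_on Y l1)
  (l2_lsc : lower_semicontinuous_on Y l2)
  (Y_convex : convex_set Y) (Y_compact : compact Y)
  (slater : exists (x : 'cV[R]_n) (u : 'cV[R]_m),
     (forall i : 'I_p, g (x, u) i ord0 < 0) /\ x - A *m x - B *m u = 0)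
  (mu : R) (mu_gt0 : 0 < mu) (mu_lt1 : mu < 1) :
  let f := linear_dynamics A B in
  let l_mu := fun z => mu * l1 z + (1 - mu) * l2 z in
  exists e : 'cV[R]_n * 'cV[R]_m,
    [/\ is_optimal_equilibrium f Y l_mu e,
        (forall e', is_optimal_equilibrium f Y l_mu e' -> e' = e)
      & strictly_dissipative N f Y l_mu e].
Proof.
move=> f l_mu.
pose E := ('cV[R]_n * 'cV[R]_m)%type.
have nu_gt0 : 0 < 1 - mu by lra.
have l_strictly_convex : strictly_convex_function (Y : set E) l_mu.
  case: l_strict => strict.
    exact: (strictly_convex_function_comb2 mu_gt0 (ltW nu_gt0)).
  have -> : l_mu = fun z => (1 - mu) * l2 z + mu * l1 z.
    by apply/funext => z; rewrite addrC.
  exact: (strictly_convex_function_comb2 nu_gt0 (ltW mu_gt0)).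
have l_convex : convex_function (Y : set E) l_mu.
  exact: (convex_function_comb2 (ltW mu_gt0) (ltW nu_gt0)).
have l_lsc : lower_semicontinuous_on Y l_mu.
  by apply: lower_semicontinuous_onD; exact: lower_semicontinuous_onZ.
have [xs [us [gs zs_eq]]] := slater.
have zs_rint : relative_interior (Y : set E) (xs, us).
  by rewrite Y_def; exact: (slater_relative_interior g_convex gs).
have zs_defect i : defect A B i (xs, us) = 0.
  by rewrite /defect /linear_dynamics /= opprD addrA zs_eq mxE.
have [|e e_opt] := optimal_equilibrium_exists (A := A) (B := B) Y_compact l_lsc.
  by exists (xs, us); apply/equilibrium_defectP; split=> //; exact: zs_rint.1.
have /equilibrium_defectP[Ye e_defect] := e_opt.1.
pose psi (z : E) := l_mu z - l_mu e.
have psi_convex : convex_function (Y : set E) psi.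
  exact: convex_functionB_cst.
have psi_strictly_convex : strictly_convex_function (Y : set E) psi.
  exact: strictly_convex_functionB_cst.
have [||c phi_ge0] := multipliers (h := fun i => defect A B i)
    Y_convex psi_convex zs_rint.
- exact: zs_defect.
- move=> z Yz zE; rewrite subr_ge0; apply: e_opt.2.
  exact/equilibrium_defectP.
pose phi z := psi z + \sum_i c i * defect A B i z.
have phi_eq_psi z : (forall i, defect A B i z = 0) -> phi z = psi z.
  by move=> zE; rewrite /phi big1 ?addr0// => i _; rewrite zE mulr0.
have phie : phi e = 0 by rewrite phi_eq_psi// /psi subrr.
have phi_strictly_convex : strictly_convex_function (Y : set E) phi.
  exact: (strictly_convex_functionD_scalar c (fun i => defect A B i)).
have phi_eq0 z : Y z -> phi z = 0 -> z = e.
  move=> Yz phiz.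
  apply: (strictly_convex_argmin_unique Y_convex phi_strictly_convex) => //.
    by move=> w Yw; rewrite phiz; exact: phi_ge0.
  by rewrite phiz phie.
exists e; split=> //.
  (* At equilibria phi is l_mu - l_mu e, so another optimum is a zero of phi. *)
  move=> e' [/equilibrium_defectP[Ye' e'_defect] e'_min].
  apply: phi_eq0 => //; apply/eqP; rewrite eq_le phi_ge0// andbT.
  by rewrite phi_eq_psi// subr_le0; exact: e'_min e_opt.1.
(* The multipliers of the equations x = A x + B u, read as a linear form. *)
pose lambda (x : 'cV[R]_n) := \sum_i x i ord0 * c i.
have lambda_cont : continuous lambda.
  apply: continuous_sum_real => i; apply: continuous_mulr.
  exact: coord_continuous.
pose d (z : E) := N (z.1 - e.1).
have d_cont : continuous d.
  move=> z; apply: (@continuous_comp _ _ _ (fun z : E => z.1 - e.1) N).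
    by apply: cvgB; [exact: cvg_fst|exact: cvg_cst].
  exact: continuous_norm_cV.
have phi_lsc : lower_semicontinuous_on Y phi.
  apply: lower_semicontinuous_onD.
    apply: lower_semicontinuous_onD => //.
    by apply: continuous_lower_semicontinuous_on => z; exact: cvg_cst.
  apply: continuous_lower_semicontinuous_on; apply: continuous_sum_real => i.
  under eq_fun do rewrite mulrC.
  by apply: continuous_mulr; exact: continuous_defect.
have [_ NZ _] := N_norm.
have [||||z t Yz t0 t1|alpha alphaK alpha_le] :=
    K_infty_lower_bound Y_compact Ye phi_lsc d_cont phie.
- by rewrite /d subrr -(scale0r 0) NZ normr0 mul0r.
- by move=> z; exact: (norm_ge0 N_norm).
- exact: phi_ge0.
- exact: phi_eq0.
- exists (t *: z + (1 - t) *: e); split.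
  + exact: (convex_set_comb Y_convex (ltW t0) (ltW t1)).
  + have phi_convex : convex_function (Y : set E) phi.
      exact: (convex_functionD_scalar c (fun i => defect A B i)).
    have := convex_function_comb phi_convex (ltW t0) (ltW t1) Yz Ye.
    by rewrite phie mulr0 addr0.
  + rewrite /d -(gtr0_norm t0) -NZ gtr0_norm//=; congr N.
    by rewrite scalerBr scalerBl scale1r addrCA addrAC subrr add0r addrC.
exists lambda; split; first exact: (linear_storage_function Y_compact).
exists alpha; split=> // x u Yxu _.
apply: le_trans (alpha_le _ Yxu) _.
rewrite /phi /psi -[leRHS]addrA lerD2l /lambda -sumrB ler_sum// => i _.
by rewrite /defect mxE [X in _ * (_ + X)]mxE mulrC mulrBl.
Qed.
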